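(* Let $b\in\mathbb{Z}[i]$ be of the form $b=-A\pm i$ with $A\in\mathbb{N}$, $A\geq 2$, and let $\tau\geq 2$ be real. For each $\lambda>0$ define \[ n_0(\lambda,\tau):=1+\max\left\{0,\ \left\lfloor \frac{\log(3/\lambda)}{\log\tau}\right\rfloor,\ \frac{\log 3}{\log|b|}\right\}. \] Then the complex number \[ \xi(\tau,\lambda)=\sum_{n\in\mathbb{N},\ n\geq n_0(\lambda,\tau)} \frac{1}{b^{\lfloor \lambda\tau^n\rfloor}} \] belongs to $\mathcal{K}_{\{0,1\}}$ and has irrationality exponent $\mu(\xi(\tau,\lambda))=\tau$. Furthermore, when $\tau=2$, the numbers $\xi(\tau,\lambda)$ are badly approximable.
   Context: For a finite set $J\subseteq\{0,1,\ldots,A^2\}$, $\mathcal{K}_{J}:=\{\sum_{j\in\mathbb{N}} d_j b^{-j} : d_j\in J \text{ for all } j\in\mathbb{N}\}$ (here $\mathbb{N}=\{1,2,\ldots\}$). For $\xi\in\mathbb{C}\setminus\mathbb{Q}(i)$, the irrationality exponent is $\mu(\xi):=\sup\{\mu\in\mathbb{R}: |\xi-p/q|<|q|^{-\mu}$ for infinitely many $p/q\in\mathbb{Q}(i)$ with $p,q\in\mathbb{Z}[i]$, $q\neq 0\}$. A number $\zeta\in\mathbb{C}\setminus\mathbb{Q}(i)$ is badly approximable if there is a constant $c>0$ such that $|\zeta-p/q|\geq c/|q|^2$ for all $p,q\in\mathbb{Z}[i]$ with $q\neq 0$. *)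

(* Defs.v *)
From Stdlib Require Import Reals ZArith List Finite_sets.
From Coquelicot Require Import Coquelicot.
Import ListNotations.
Open Scope R_scope.

(* Stdlib reals and Coquelicot complex numbers.  The index set of the sums is
   {1, 2, ...}, so the series (indexed from 0 by Coquelicot) are shifted by one. *)

Definition gaussian_integer (z : C) : Prop :=
  exists x y : Z, z = (IZR x, IZR y).

Definition gaussian_rational (z : C) : Prop :=
  exists p q : C, gaussian_integer p /\ gaussian_integer q /\ q <> 0 /\
    z = (p / q)%C.

Definition K_set (b : C) (J : list nat) (z : C) : Prop :=
  exists d : nat -> nat, (forall j : nat, (1 <= j)%nat -> In (d j) J) /\
    is_series (fun k : nat => (RtoC (INR (d (S k))) / Cpow b (S k))%C) z.

(* Infinitely many values [p/q] (not pairs [(p, q)]). *)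
Definition infinitely_often_approximable (xi : C) (mu : R) : Prop :=
  ~ Finite_sets.Finite C (fun z : C =>
      exists p q : C, gaussian_integer p /\ gaussian_integer q /\ q <> 0 /\
        z = (p / q)%C /\ Cmod (xi - p / q)%C < Rpower (Cmod q) (- mu)).

(* The supremum is taken in the extended reals. *)
Definition irrationality_exponent (xi : C) : Rbar :=
  Lub_Rbar (infinitely_often_approximable xi).

Definition badly_approximable (zeta : C) : Prop :=
  ~ gaussian_rational zeta /\
  exists c : R, 0 < c /\
    forall p q : C, gaussian_integer p -> gaussian_integer q -> q <> 0 ->
      c / Cmod q ^ 2 <= Cmod (zeta - p / q)%C.

(* [Int_part] is the floor function. *)
Definition n0 (b : C) (lambda tau : R) : R :=
  1 + Rmax 0 (Rmax (IZR (Int_part (ln (3 / lambda) / ln tau)))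
                   (ln 3 / ln (Cmod b))).

Definition xi_exponent (tau lambda : R) (n : nat) : nat :=
  Z.to_nat (Int_part (lambda * tau ^ n)).

Definition xi_term (b : C) (tau lambda : R) (n : nat) : C :=
  if Rle_dec (n0 b lambda tau) (INR n)
  then (1 / Cpow b (xi_exponent tau lambda n))%C
  else 0.

(* Coquelicot's total operator [Series] is real-valued: sum componentwise. *)
Definition xi (b : C) (tau lambda : R) : C :=
  (Series (fun k : nat => Re (xi_term b tau lambda (S k))),
   Series (fun k : nat => Im (xi_term b tau lambda (S k)))).

(* Main.v *)
Require Import Defs.
From Stdlib Require Import Finite_sets_facts Reals List Lra Lia ZArith.
From Coquelicot Require Import Coquelicot.
Import ListNotations.
Open Scope R_scope.

(* Write [q_k = b^(e_k)] for the denominators of the partial sums [P_k / q_k] of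
   the series.  As [tau >= 2], [e_(k+1) >= 2 e_k], so with [u = b^(e_(k+1) - 2 e_k)]
   one has [q_(k+1) = u q_k^2] and [P_(k+1) = u q_k P_k + 1]: this is the folding
   lemma for continued fractions.  For a vector [v = (p', q')] put
   [delta_k(v) = q' P_k - p' q_k].  Then [delta_(k+1)(v) = u q_k delta_k(v) + q'],
   while [v - u delta_k(v) (P_k, q_k)] has the denominator [q' - u q_k delta_k(v)]
   and the remainder [q'] at level [k+1].  Hence two independent vectors of
   Gaussian integers with denominators about [Q] and remainders about [|q_k| / Q]
   yield such pairs at level [k+1] for the scales [Q] and [|q_(k+1)| / Q], and a new
   gap between good scales arises only from [|q_k|] to [|u| |q_k|], where [|u|] is
   about [|q_k|^(tau - 2)].  So near every [x] there are two independent good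
   approximations to [xi] with denominators between [x] and a constant times
   [x^(tau - 1)].  One of them differs from a given [p / q], and comparing the two
   gives [|xi - p / q| >= c |q|^(-tau)].  The partial sums show that the exponent
   [tau] is attained. *)

(** * Arithmetic of the Gaussian integers *)

Lemma gaussian_integer_add (x y : C) :
  gaussian_integer x -> gaussian_integer y -> gaussian_integer (x + y)%C.
Proof.
  intros [a [a' ->]] [c [c' ->]]. exists (a + c)%Z, (a' + c')%Z.
  now rewrite !plus_IZR.
Qed.

Lemma gaussian_integer_opp (x : C) :
  gaussian_integer x -> gaussian_integer (- x)%C.
Proof.
  intros [a [a' ->]]. exists (- a)%Z, (- a')%Z. now rewrite !opp_IZR.
Qed.

Lemma gaussian_integer_sub (x y : C) :
  gaussian_integer x -> gaussian_integer y -> gaussian_integer (x - y)%C.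
Proof.
  intros hx hy. now apply gaussian_integer_add, gaussian_integer_opp.
Qed.

Lemma gaussian_integer_mul (x y : C) :
  gaussian_integer x -> gaussian_integer y -> gaussian_integer (x * y)%C.
Proof.
  intros [a [a' ->]] [c [c' ->]]. exists (a * c - a' * c')%Z, (a * c' + a' * c)%Z.
  unfold Cmult; simpl. now rewrite minus_IZR, plus_IZR, !mult_IZR.
Qed.

Lemma gaussian_integer_IZR (n : Z) : gaussian_integer (RtoC (IZR n)).
Proof. now exists n, 0%Z. Qed.

Lemma gaussian_integer_pow (x : C) (n : nat) :
  gaussian_integer x -> gaussian_integer (Cpow x n).
Proof.
  intros hx. induction n as [|n IH]; simpl.
  - apply (gaussian_integer_IZR 1).
  - now apply gaussian_integer_mul.
Qed.

Lemma gaussian_integer_Cmod_ge_1 (x : C) :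
  gaussian_integer x -> x <> 0 -> 1 <= Cmod x.
Proof.
  intros [a [c ->]] hx. unfold Cmod; simpl. rewrite <- sqrt_1 at 1.
  apply sqrt_le_1_alt. rewrite !Rmult_1_r, <- !mult_IZR, <- plus_IZR.
  apply IZR_le.
  assert (a <> 0 \/ c <> 0)%Z.
  { destruct (Z.eq_dec a 0) as [->|]; [|now left].
    destruct (Z.eq_dec c 0) as [->|]; [|now right]. now elim hx. }
  nia.
Qed.

(** * Pairs of independent approximations under folding *)

(** For the lattice of vectors [(q', q' * P - p' * q)], of determinant [q] up to sign, this says
    that the second successive minimum with respect to the box of radii [X] and [Y] is at most
    one. *)
Definition independent_approximants (P q : C) (X Y : R) : Prop :=
  exists p1 q1 p2 q2 : C,
    gaussian_integer p1 /\ gaussian_integer q1 /\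
    gaussian_integer p2 /\ gaussian_integer q2 /\
    (p1 * q2 - q1 * p2)%C <> 0 /\
    Cmod q1 <= X /\ Cmod q2 <= X /\
    Cmod (q1 * P - p1 * q)%C <= Y /\ Cmod (q2 * P - p2 * q)%C <= Y.

Lemma independent_approximants_le (P q : C) (X Y X' Y' : R) :
  X <= X' -> Y <= Y' ->
  independent_approximants P q X Y -> independent_approximants P q X' Y'.
Proof.
  intros hX hY (p1 & q1 & p2 & q2 & h1 & h2 & h3 & h4 & h5 & h6 & h7 & h8 & h9).
  exists p1, q1, p2, q2. repeat split; auto; lra.
Qed.

Lemma Cmod_fold_le (u q d x : C) (X Y : R) :
  Cmod x <= X -> Cmod d <= Y -> Cmod (u * q * d + x)%C <= Cmod u * Cmod q * Y + X.
Proof.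
  intros hx hd. apply Rle_trans with (1 := Cmod_triangle _ _). rewrite !Cmod_mult.
  apply Rplus_le_compat; auto. apply Rmult_le_compat_l; auto.
  apply Rmult_le_pos; apply Cmod_ge_0.
Qed.

Lemma independent_approximants_fold_small (P q u : C) (X Y : R) :
  independent_approximants P q X Y ->
  independent_approximants (u * q * P + 1) (u * q * q)
    X (Cmod u * Cmod q * Y + X).
Proof.
  intros (p1 & q1 & p2 & q2 & h1 & h2 & h3 & h4 & h5 & h6 & h7 & h8 & h9).
  exists p1, q1, p2, q2. repeat split; auto.
  - replace (q1 * _ - _)%C with (u * q * (q1 * P - p1 * q) + q1)%C by ring.
    now apply Cmod_fold_le.
  - replace (q2 * _ - _)%C with (u * q * (q2 * P - p2 * q) + q2)%C by ring.
    now apply Cmod_fold_le.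
Qed.

(* The vectors [v - u * delta(v) * (P, q)], where [delta (p', q') = q' P - p' q]:
   this transvection preserves determinants and exchanges the sizes of the
   denominator and of the remainder. *)
Lemma independent_approximants_fold_large (P q u : C) (X Y : R) :
  gaussian_integer P -> gaussian_integer q -> gaussian_integer u ->
  independent_approximants P q X Y ->
  independent_approximants (u * q * P + 1) (u * q * q)
    (Cmod u * Cmod q * Y + X) X.
Proof.
  intros hP hq hu (p1 & q1 & p2 & q2 & h1 & h2 & h3 & h4 & h5 & h6 & h7 & h8 & h9).
  exists (p1 - u * (q1 * P - p1 * q) * P)%C, (q1 - u * (q1 * P - p1 * q) * q)%C,
    (p2 - u * (q2 * P - p2 * q) * P)%C, (q2 - u * (q2 * P - p2 * q) * q)%C.
  assert (hneg : forall x d : C, Cmod x <= X -> Cmod d <= Y ->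
    Cmod (x - u * d * q)%C <= Cmod u * Cmod q * Y + X).
  { intros x d hx hd. replace (x - u * d * q)%C with (u * q * - d + x)%C by ring.
    apply Cmod_fold_le; auto. now rewrite Cmod_opp. }
  repeat split; auto 7 using gaussian_integer_sub, gaussian_integer_mul.
  - intros h. apply h5. rewrite <- h. ring.
  - match goal with |- Cmod ?z <= _ => replace z with q1 by ring end. exact h6.
  - match goal with |- Cmod ?z <= _ => replace z with q2 by ring end. exact h7.
Qed.

(** * Folding sequences and their good scales *)

(** [phi] bounds the gap between good scales opened at each level; its monotonicity lets a gap be
    moved to a larger scale. In the application it is a constant times the power [tau - 2]. *)
Record folding_sequence (P q u : nat -> C) (phi : R -> R) : Prop := {
  fold_P_int : forall k, gaussian_integer (P k);
  fold_q_int : forall k, gaussian_integer (q k);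
  fold_u_int : forall k, gaussian_integer (u k);
  fold_P0 : P 0%nat = 1;
  fold_P_succ : forall k, P (S k) = (u k * q k * P k + 1)%C;
  fold_q_succ : forall k, q (S k) = (u k * q k * q k)%C;
  fold_q_ge : forall k, 2 <= Cmod (q k);
  fold_u_ge : forall k, 1 <= Cmod (u k);
  fold_u_le : forall k, Cmod (u k) <= phi (Cmod (q k));
  fold_phi_ge : forall x, 1 <= x -> 1 <= phi x;
  fold_phi_mono : forall x y, 1 <= x -> x <= y -> phi x <= phi y
}.

(* One folding multiplies the bounds at scale [Q] by [1 + Q^2 / T'], where [T'] is
   the next denominator; the growth of this weight absorbs all these factors, and
   it is invariant under [Q -> T / Q]. *)
Definition fold_weight (K T Q : R) : R := K * exp (- 2 * (/ Q + Q / T)).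

Lemma fold_weight_le (K T Q : R) :
  0 <= K -> 0 < Q -> 0 < T -> fold_weight K T Q <= K.
Proof.
  intros hK hQ hT. unfold fold_weight. rewrite <- (Rmult_1_r K) at 2.
  apply Rmult_le_compat_l; auto. rewrite <- exp_0.
  left; apply exp_increasing.
  assert (0 < / Q) by now apply Rinv_0_lt_compat.
  assert (0 < Q / T) by now apply Rdiv_lt_0_compat. lra.
Qed.

Lemma fold_weight_inv (K T Q : R) :
  0 < Q -> 0 < T -> fold_weight K T (T / Q) = fold_weight K T Q.
Proof.
  intros hQ hT. unfold fold_weight. do 2 f_equal. f_equal. field. lra.
Qed.

(** Put [T' = U * T * T] and [z = Q^2 / T'], so that [1 + z <= exp z]. As [T' >= 2 * T], passing
    from [T] to [T'] raises the exponent in the weight by at least [Q / T], which is at least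
    [z]. *)
Lemma fold_weight_step (K T U Q : R) :
  0 <= K -> 2 <= T -> 1 <= U -> 1 <= Q <= T ->
  fold_weight K T Q * (1 + Q * Q / (U * T * T)) <= fold_weight K (U * T * T) Q.
Proof.
  intros hK hT hU hQ. unfold fold_weight.
  set (z := Q * Q / (U * T * T)).
  assert (hTT : 2 * T <= U * T * T) by nra.
  apply Rle_trans with (K * (exp (-2 * (/ Q + Q / T)) * exp z)).
  - rewrite Rmult_assoc. apply Rmult_le_compat_l; auto.
    apply Rmult_le_compat_l; [left; apply exp_pos|]. apply exp_ineq1_le.
  - apply Rmult_le_compat_l; auto. rewrite <- exp_plus.
    assert (h : -2 * (/ Q + Q / T) + z <= -2 * (/ Q + Q / (U * T * T))).
    { unfold z.
      assert (h1 : Q / (U * T * T) <= / 2 * (Q / T)).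
      { apply Rmult_le_reg_r with (2 * T * (U * T * T)); [nra|].
        replace (Q / (U * T * T) * (2 * T * (U * T * T))) with (Q * (2 * T)) by (field; nra).
        replace (/ 2 * (Q / T) * (2 * T * (U * T * T))) with (Q * (U * T * T)) by (field; nra).
        apply Rmult_le_compat_l; lra. }
      assert (h2 : Q * Q / (U * T * T) <= Q / T).
      { apply Rmult_le_reg_r with (T * (U * T * T)); [nra|].
        replace (Q * Q / (U * T * T) * (T * (U * T * T))) with (Q * (Q * T)) by (field; nra).
        replace (Q / T * (T * (U * T * T))) with (Q * (U * T * T)) by (field; nra).
        apply Rmult_le_compat_l; nra. }
      lra. }
    destruct h as [h|h]; [left; now apply exp_increasing | rewrite h; apply Rle_refl].
Qed.

(** The two bounds multiply to [|q k|] times the square of the weight, which is within a constant of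
    the least product that the determinant allows. *)
Definition good_scale (P q : nat -> C) (K : R) (k : nat) (Q : R) : Prop :=
  1 <= Q <= Cmod (q k) /\
  independent_approximants (P k) (q k)
    (fold_weight K (Cmod (q k)) Q * Q) (fold_weight K (Cmod (q k)) Q * (Cmod (q k) / Q)).

(** The scale [Q] survives with the same vectors; its mirror image [|q (S k)| / Q] comes from the
    transvected ones and has the same weight by [fold_weight_inv]. *)
Lemma good_scale_step (P q u : nat -> C) (phi : R -> R) (K : R) (k : nat) (Q : R) :
  folding_sequence P q u phi -> 0 <= K -> good_scale P q K k Q ->
  good_scale P q K (S k) Q /\ good_scale P q K (S k) (Cmod (q (S k)) / Q).
Proof.
  intros F hK [hQ hgood]. unfold good_scale.
  assert (hT := fold_q_ge _ _ _ _ F k). assert (hU := fold_u_ge _ _ _ _ F k).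
  rewrite (fold_q_succ _ _ _ _ F k), (fold_P_succ _ _ _ _ F k), !Cmod_mult.
  set (T := Cmod (q k)) in *. set (U := Cmod (u k)) in *.
  assert (hTT : T <= U * T * T) by nra.
  assert (hw := fold_weight_step K T U Q hK hT hU hQ).
  assert (hw0 : 0 <= fold_weight K T Q)
    by (apply Rmult_le_pos; auto; left; apply exp_pos).
  assert (hz : 0 < Q * Q / (U * T * T)) by (apply Rdiv_lt_0_compat; nra).
  assert (hX : fold_weight K T Q * Q <= fold_weight K (U * T * T) Q * Q).
  { apply Rmult_le_compat_r; [lra|]. nra. }
  assert (hY : U * T * (fold_weight K T Q * (T / Q)) + fold_weight K T Q * Q
    <= fold_weight K (U * T * T) Q * (U * T * T / Q)).
  { replace (_ + _) with
      (fold_weight K T Q * (1 + Q * Q / (U * T * T)) * (U * T * T / Q)) by (field; lra).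
    apply Rmult_le_compat_r; auto. left; apply Rdiv_lt_0_compat; nra. }
  split.
  - split; [lra|].
    apply independent_approximants_le with (1 := hX) (2 := hY).
    now apply independent_approximants_fold_small.
  - split.
    + split.
      * apply Rmult_le_reg_r with Q; [lra|]. unfold Rdiv.
        rewrite Rmult_assoc, Rinv_l; lra.
      * apply Rmult_le_reg_r with Q; [lra|]. unfold Rdiv.
        rewrite Rmult_assoc, Rinv_l; nra.
    + rewrite fold_weight_inv by nra.
      replace (U * T * T / (U * T * T / Q)) with Q by (field; nra).
      apply independent_approximants_le with (1 := hY) (2 := hX).
      apply independent_approximants_fold_large; auto; apply F.
Qed.

(* The ratio of two consecutive good scales at level [k] is at most the gap [|u j|]
   created at some earlier level [j], mirrored to a possibly larger scale. *)
Lemma good_scale_gap (P q u : nat -> C) (phi : R -> R) :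
  folding_sequence P q u phi ->
  exists K, 1 <= K /\ forall k x, 1 <= x <= Cmod (q k) ->
    exists Q1 Q2, good_scale P q K k Q1 /\ good_scale P q K k Q2 /\
      Q1 <= x <= Q2 /\ Q2 <= phi Q1 * Q1.
Proof.
  intros F. set (T0 := Cmod (q 0%nat)).
  assert (hT0 : 2 <= T0) by apply (fold_q_ge _ _ _ _ F).
  (* [exp 4] cancels the weight at level 0, where [/ x + x / T0 <= 2], and [T0] leaves room at every
     scale for the vectors [(0, 1)] and [(1, 0)], whose remainders are [1] and [- q 0]. *)
  exists (T0 * exp 4).
  assert (he : 1 <= exp 4) by (generalize (exp_ineq1_le 4); lra).
  assert (hK : 1 <= T0 * exp 4) by nra.
  split; auto. induction k as [|k IH]; intros x hx.
  - assert (hg : good_scale P q (T0 * exp 4) 0 x).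
    { split; auto. fold T0 in hx |- *.
      assert (hw : T0 <= fold_weight (T0 * exp 4) T0 x).
      { unfold fold_weight. rewrite Rmult_assoc, <- exp_plus.
        rewrite <- (Rmult_1_r T0) at 1. apply Rmult_le_compat_l; [lra|].
        rewrite <- exp_0.
        assert (/ x <= 1) by (rewrite <- Rinv_1; apply Rinv_le_contravar; lra).
        assert (x / T0 <= 1).
        { apply Rmult_le_reg_r with T0; [lra|]. unfold Rdiv.
          rewrite Rmult_assoc, Rinv_l; lra. }
        destruct (Req_dec (4 + -2 * (/ x + x / T0)) 0) as [->|]; [lra|].
        left. apply exp_increasing. lra. }
      apply independent_approximants_le with 1 T0; [nra| |].
      - apply Rle_trans with (T0 * (T0 / x)).
        + apply Rmult_le_reg_r with x; [lra|].
          replace (T0 * (T0 / x) * x) with (T0 * T0) by (field; lra). nra.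
        + apply Rmult_le_compat_r; auto. left; apply Rdiv_lt_0_compat; lra.
      - exists 0, 1, 1, 0.
        rewrite (fold_P0 _ _ _ _ F).
        repeat split; try apply (gaussian_integer_IZR 0);
          try apply (gaussian_integer_IZR 1).
        + intros h. apply (f_equal fst) in h. simpl in h. lra.
        + rewrite Cmod_1. lra.
        + rewrite Cmod_0. lra.
        + replace (1 * 1 - 0 * q 0%nat)%C with (RtoC 1) by ring. rewrite Cmod_1. lra.
        + replace (0 * 1 - 1 * q 0%nat)%C with (- q 0%nat)%C by ring.
          rewrite Cmod_opp. apply Rle_refl. }
    exists x, x. repeat split; auto; try apply hg; try lra.
    assert (h := fold_phi_ge _ _ _ _ F x). nra.
  - assert (hT := fold_q_ge _ _ _ _ F k). assert (hU := fold_u_ge _ _ _ _ F k).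
    assert (hTS : Cmod (q (S k)) = Cmod (u k) * Cmod (q k) * Cmod (q k))
      by now rewrite (fold_q_succ _ _ _ _ F k), !Cmod_mult.
    assert (hstep := fun Q => good_scale_step P q u phi _ k Q F (Rle_trans _ _ _ Rle_0_1 hK)).
    (* Up to [|q k|] the old scales serve; from there to [|u k| * |q k|] lies the only new gap;
       beyond it, [x -> |q (S k)| / x] leads back to the first range. *)
    destruct (Rle_dec x (Cmod (q k))) as [h1|h1].
    + destruct (IH x) as (Q1 & Q2 & g1 & g2 & h); [lra|].
      exists Q1, Q2. split; [now apply hstep|]. split; [now apply hstep|exact h].
    + destruct (Rle_dec x (Cmod (u k) * Cmod (q k))) as [h2|h2].
      (* The top scale is good: the upper scale that the induction hypothesis gives for [|q k|]
         cannot exceed [|q k|]. *)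
      * assert (hg : good_scale P q (T0 * exp 4) k (Cmod (q k))).
        { destruct (IH (Cmod (q k))) as (Q1 & Q2 & g1 & g2 & h & _); [lra|].
          replace (Cmod (q k)) with Q2; auto. destruct g2 as [g2 _]. lra. }
        exists (Cmod (q k)), (Cmod (u k) * Cmod (q k)).
        split; [now apply hstep|]. split.
        { replace (Cmod (u k) * Cmod (q k)) with (Cmod (q (S k)) / Cmod (q k))
            by (rewrite hTS; field; lra).
          now apply hstep. }
        split; [lra|]. apply Rmult_le_compat_r; [lra|]. apply F.
      * assert (hxq : Cmod (q (S k)) / x <= Cmod (q k)).
        { apply Rmult_le_reg_r with x; [lra|]. unfold Rdiv.
          rewrite Rmult_assoc, Rinv_l, hTS; nra. }
        assert (hxq1 : 1 <= Cmod (q (S k)) / x).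
        { apply Rmult_le_reg_r with x; [lra|]. unfold Rdiv.
          rewrite Rmult_assoc, Rinv_l; lra. }
        destruct (IH (Cmod (q (S k)) / x)) as (Q1 & Q2 & g1 & g2 & h & h'); [lra|].
        assert (hQ1 := proj1 g1). assert (hQ2 := proj1 g2).
        exists (Cmod (q (S k)) / Q2), (Cmod (q (S k)) / Q1).
        split; [now apply hstep|]. split; [now apply hstep|].
        set (T' := Cmod (q (S k))) in *.
        assert (hT' : T' = T' / x * x) by (field; lra).
        split; [split|].
        -- apply Rmult_le_reg_r with Q2; [lra|]. unfold Rdiv at 1.
           rewrite Rmult_assoc, Rinv_l; nra.
        -- apply Rmult_le_reg_r with Q1; [lra|]. unfold Rdiv at 1.
           rewrite Rmult_assoc, Rinv_l; nra.
        (* Mirroring preserves the ratio [Q2 / Q1], and [Q1 <= T' / Q2], so the monotonicity of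
           [phi] gives the bound at the new lower scale. *)
        -- assert (hm : phi Q1 <= phi (T' / Q2)).
           { apply (fold_phi_mono _ _ _ _ F); [lra|].
             apply Rmult_le_reg_r with Q2; [lra|]. unfold Rdiv.
             rewrite Rmult_assoc, Rinv_l by lra. nra. }
           apply Rle_trans with (phi Q1 * (T' / Q2)).
           ++ apply Rmult_le_reg_r with (Q1 * Q2); [nra|].
              replace (T' / Q1 * (Q1 * Q2)) with (T' * Q2) by (field; lra).
              replace (phi Q1 * (T' / Q2) * (Q1 * Q2)) with (T' * (phi Q1 * Q1))
                by (field; lra).
              apply Rmult_le_compat_l; auto. nra.
           ++ apply Rmult_le_compat_r; auto. left; apply Rdiv_lt_0_compat; nra.
Qed.

(** * Lower bounds from good approximations *)

(** Two independent vectors cannot both be proportional to [(p0, q0)]. The determinant of [(p0, q0)]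
    with one that is not is a nonzero Gaussian integer, hence of modulus at least 1. *)
Lemma independent_approximants_lower_bound (P q zeta p0 q0 : C) (X Y e : R) :
  independent_approximants P q X Y -> q <> 0 ->
  gaussian_integer p0 -> gaussian_integer q0 -> q0 <> 0 ->
  Cmod (zeta - P / q)%C <= e ->
  1 <= X * Cmod (p0 - q0 * zeta)%C + Cmod q0 * (Y / Cmod q + X * e).
Proof.
  intros (p1 & q1 & p2 & q2 & h1 & h2 & h3 & h4 & h5 & h6 & h7 & h8 & h9)
    hq hp0 hq0 hnz he.
  assert (hmain : forall p' q' : C, gaussian_integer p' -> gaussian_integer q' ->
    (p0 * q' - q0 * p')%C <> 0 -> Cmod q' <= X -> Cmod (q' * P - p' * q)%C <= Y ->
    1 <= X * Cmod (p0 - q0 * zeta)%C + Cmod q0 * (Y / Cmod q + X * e)).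
  { intros p' q' hp' hq' hdet hX hY.
    apply Rle_trans with (Cmod (p0 * q' - q0 * p')%C).
    { apply gaussian_integer_Cmod_ge_1; auto.
      auto using gaussian_integer_sub, gaussian_integer_mul. }
    (* Here [q' * zeta - p'] is split into the remainder at [P / q] and the error of [P / q]
       itself. *)
    replace (p0 * q' - q0 * p')%C with
      (q' * (p0 - q0 * zeta) + q0 * ((q' * P - p' * q) / q + q' * (zeta - P / q)))%C
      by (field; exact hq).
    apply Rle_trans with (1 := Cmod_triangle _ _). rewrite !Cmod_mult.
    apply Rplus_le_compat.
    - apply Rmult_le_compat_r; auto. apply Cmod_ge_0.
    - apply Rmult_le_compat_l; [apply Cmod_ge_0|].
      apply Rle_trans with (1 := Cmod_triangle _ _).
      rewrite Cmod_mult, Cmod_div by exact hq.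
      apply Rplus_le_compat.
      + apply Rmult_le_compat_r; auto. left.
        apply Rinv_0_lt_compat. now apply Cmod_gt_0.
      + apply Rmult_le_compat; auto; apply Cmod_ge_0. }
  destruct (Ceq_dec (p0 * q1 - q0 * p1)%C 0) as [e1|n1]; [|now apply (hmain p1 q1)].
  destruct (Ceq_dec (p0 * q2 - q0 * p2)%C 0) as [e2|n2]; [|now apply (hmain p2 q2)].
  (* If both determinants vanish, so does [q0 * (p1 * q2 - q1 * p2)]. *)
  elim (Cmult_neq_0 _ _ hnz h5).
  transitivity (q1 * (p0 * q2 - q0 * p2) - q2 * (p0 * q1 - q0 * p1))%C; [ring|].
  rewrite e1, e2. ring.
Qed.

(** Take a good scale [Q] between [x = 4 * K * |q0|] and [phi x * x]. Remainder and truncation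
    together contribute at most [2 * K * |q0| / Q <= 1 / 2] to the determinant bound, so the term
    with [p0 - q0 * zeta] accounts for the other half. *)
Lemma folding_lower_bound (P q u : nat -> C) (phi : R -> R) (zeta : C) :
  folding_sequence P q u phi ->
  (forall e M, 0 < e -> exists k, Cmod (zeta - P k / q k)%C <= e /\ M <= Cmod (q k)) ->
  exists K, 1 <= K /\ forall p0 q0 : C,
    gaussian_integer p0 -> gaussian_integer q0 -> q0 <> 0 ->
    1 <= 2 * K * (phi (4 * K * Cmod q0) * (4 * K * Cmod q0)) * Cmod (p0 - q0 * zeta)%C.
Proof.
  intros F hlim. destruct (good_scale_gap P q u phi F) as [K [hK hgap]].
  exists K. split; auto. intros p0 q0 hp0 hq0 hnz.
  assert (hq1 := gaussian_integer_Cmod_ge_1 q0 hq0 hnz).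
  set (x := 4 * K * Cmod q0). assert (hx : 4 <= x) by (unfold x; nra).
  set (B := phi x * x).
  assert (hphi := fold_phi_ge _ _ _ _ F x ltac:(lra)).
  assert (hB : 1 <= B) by (unfold B; nra).
  (* [Q] depends on the level [k], but [Q <= B] at every level; a truncation error of [1 / B^2] is
     therefore at most [1 / Q^2]. *)
  destruct (hlim (/ (B * B)) x) as [k [hk1 hk2]]; [apply Rinv_0_lt_compat; nra|].
  destruct (hgap k x) as (Q1 & Q & [hQ1 _] & [hQ hgood] & h & h'); [lra|].
  assert (hT := fold_q_ge _ _ _ _ F k).
  set (T := Cmod (q k)) in *.
  assert (hQB : Q <= B).
  { assert (hm : phi Q1 <= phi x) by (apply (fold_phi_mono _ _ _ _ F); lra).
    assert (1 <= phi Q1) by (apply (fold_phi_ge _ _ _ _ F); lra).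
    unfold B. nra. }
  assert (hw : fold_weight K T Q <= K) by (apply fold_weight_le; lra).
  assert (hqk : q k <> 0).
  { intros h0. unfold T in hT. rewrite h0, Cmod_0 in hT. lra. }
  assert (hgood' : independent_approximants (P k) (q k) (K * Q) (K * (T / Q))).
  { apply independent_approximants_le with (3 := hgood).
    - apply Rmult_le_compat_r; lra.
    - apply Rmult_le_compat_r; auto. left; apply Rdiv_lt_0_compat; lra. }
  assert (hlb := independent_approximants_lower_bound _ _ _ _ _ _ _ _
    hgood' hqk hp0 hq0 hnz hk1). fold T in hlb.
  set (D := Cmod (p0 - q0 * zeta)%C) in *.
  assert (hD : 0 <= D) by apply Cmod_ge_0.
  assert (h1 : K * (T / Q) / T = K / Q) by (field; lra).
  assert (h2 : K * Q * / (B * B) <= K / Q).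
  { apply Rmult_le_reg_r with (Q * (B * B)); [apply Rmult_lt_0_compat; nra|].
    replace (K * Q * / (B * B) * (Q * (B * B))) with (K * (Q * Q)) by (field; lra).
    replace (K / Q * (Q * (B * B))) with (K * (B * B)) by (field; lra).
    apply Rmult_le_compat_l; nra. }
  assert (h3 : Cmod q0 * (2 * (K / Q)) <= / 2).
  { apply Rmult_le_reg_r with (2 * Q); [lra|].
    replace (Cmod q0 * (2 * (K / Q)) * (2 * Q)) with x by (unfold x; field; lra).
    lra. }
  rewrite h1 in hlb.
  assert (h4 : Cmod q0 * (K / Q + K * Q * / (B * B)) <= Cmod q0 * (2 * (K / Q)))
    by (apply Rmult_le_compat_l; lra).
  assert (h5 : K * Q * D <= K * B * D)
    by (apply Rmult_le_compat_r; auto; apply Rmult_le_compat_l; lra).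
  lra.
Qed.

(** * Complex series through moduli and components *)

Lemma is_series_C_Cmod (a : nat -> C) (z : C) :
  is_series a z <->
  forall e, 0 < e -> exists n0, forall n, (n0 <= n)%nat -> Cmod (z - sum_n a n)%C < e.
Proof.
  unfold is_series.
  rewrite (filterlim_locally (U := C_UniformSpace) (sum_n a) z).
  split.
  - intros h e he.
    (* The uniform balls of [C] are taken componentwise, so radius [r] only gives a modulus below
       [sqrt 2 * r]. *)
    assert (hs : 0 < sqrt 2) by (apply sqrt_lt_R0; lra).
    assert (he' : 0 < e / sqrt 2) by now apply Rdiv_lt_0_compat.
    destruct (h (mkposreal _ he')) as [n0 hn0]. exists n0. intros n hn.
    assert (hb := C_NormedModule_mixin_compat2 _ _ _ (hn0 n hn)).
    simpl in hb. replace (sqrt 2 * (e / sqrt 2)) with e in hb by (field; lra).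
    rewrite <- Cmod_opp, Copp_minus_distr. exact hb.
  - intros h e. destruct (h e (cond_pos e)) as [n0 hn0]. exists n0. intros n hn.
    apply C_NormedModule_mixin_compat1.
    change (Cmod (sum_n a n - z)%C < e).
    rewrite <- Cmod_opp, Copp_minus_distr. now apply hn0.
Qed.

Lemma sum_n_Re (a : nat -> C) (n : nat) : sum_n (fun k => Re (a k)) n = Re (sum_n a n).
Proof.
  induction n as [|n IH]; [now rewrite !sum_O|].
  now rewrite !sum_Sn, IH.
Qed.

Lemma sum_n_Im (a : nat -> C) (n : nat) : sum_n (fun k => Im (a k)) n = Im (sum_n a n).
Proof.
  induction n as [|n IH]; [now rewrite !sum_O|].
  now rewrite !sum_Sn, IH.
Qed.

(** Serves to identify [xi], defined componentwise, with the sum of its series; both projections are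
    1-Lipschitz for the modulus. *)
Lemma Series_Re_Im (a : nat -> C) (z : C) :
  is_series a z -> (Series (fun k => Re (a k)), Series (fun k => Im (a k))) = z.
Proof.
  intros h. rewrite is_series_C_Cmod in h.
  assert (hpart : forall (f : C -> R) (l : nat -> R),
    (forall n, sum_n l n = f (sum_n a n)) ->
    (forall x y : C, Rabs (f x - f y) <= Cmod (y - x)%C) -> is_series l (f z)).
  { intros f l hl hf.
    apply (filterlim_locally (U := R_UniformSpace)). intros e.
    destruct (h e (cond_pos e)) as [n0 hn0]. exists n0. intros n hn.
    rewrite hl. apply Rle_lt_trans with (1 := hf _ _). now apply hn0. }
  rewrite (surjective_pairing z). f_equal; apply is_series_unique.
  - apply hpart; [apply sum_n_Re|]. intros x y. rewrite Rabs_minus_sym.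
    apply Rle_trans with (2 := Rmax_Cmod _). apply Rmax_l.
  - apply hpart; [apply sum_n_Im|]. intros x y. rewrite Rabs_minus_sym.
    apply Rle_trans with (2 := Rmax_Cmod _). apply Rmax_r.
Qed.

Lemma Ceq_of_Cmod_small (x y : C) : (forall e, 0 < e -> Cmod (x - y)%C < e) -> x = y.
Proof.
  intros h. destruct (Ceq_dec (x - y)%C 0) as [e|n].
  - replace x with (x - y + y)%C by ring. rewrite e. ring.
  - apply Cmod_gt_0 in n. specialize (h _ n). lra.
Qed.

Lemma ex_series_C_geom (a : nat -> C) (r : R) :
  0 <= r < 1 -> (forall k, Cmod (a k) <= r ^ k) -> exists z, is_series a z.
Proof.
  intros hr ha.
  apply (ex_series_le (V := C_CompleteNormedModule) a (fun k => r ^ k)).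
  - intros k. apply ha.
  - apply ex_series_geom. rewrite Rabs_pos_eq; lra.
Qed.

Lemma sum_n_C_succ (a : nat -> C) (n : nat) :
  sum_n a (S n) = (sum_n a n + a (S n))%C :> C.
Proof. exact (sum_Sn a n). Qed.

Lemma sum_n_zero_prefix (c : nat -> C) (m : nat) :
  (forall j, (j < m)%nat -> c j = 0) -> sum_n c m = c m :> C.
Proof.
  induction m as [|m IH]; intros h; [apply sum_O|].
  rewrite sum_n_C_succ, IH by (intros; apply h; lia). rewrite (h m) by lia.
  apply Cplus_0_l.
Qed.

Lemma sum_n_zero_stretch (c : nat -> C) (m l : nat) :
  (forall j, (m < j <= m + l)%nat -> c j = 0) -> sum_n c (m + l) = sum_n c m :> C.
Proof.
  induction l as [|l IH]; intros h; [now rewrite Nat.add_0_r|].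
  rewrite Nat.add_succ_r, sum_n_C_succ, IH by (intros; apply h; lia).
  rewrite (h (S (m + l))) by lia. apply Cplus_0_r.
Qed.

(** * Lacunary series with doubling exponents *)

Record doubling_exponents (E : nat -> nat) : Prop := {
  doubling_0 : (2 <= E 0)%nat;
  doubling_succ : forall k, (2 * E k <= E (S k))%nat
}.

Lemma doubling_lt (E : nat -> nat) (i j : nat) :
  doubling_exponents E -> (i < j)%nat -> (E i < E j)%nat.
Proof.
  intros [h0 hS] hij.
  assert (hpos : forall k, (1 <= E k)%nat).
  { induction k as [|k IH]; [lia|]. specialize (hS k). lia. }
  induction hij as [|j hij IH].
  - specialize (hS i). specialize (hpos i). lia.
  - specialize (hS j). lia.
Qed.

Lemma doubling_ge (E : nat -> nat) (k : nat) :
  doubling_exponents E -> (k + 2 <= E k)%nat.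
Proof.
  intros H. induction k as [|k IH]; [apply H|].
  assert (h := doubling_lt E k (S k) H). lia.
Qed.

(** The multiplier [u k] of the folding; the truncated subtraction is exact for doubling
    exponents. *)
Definition lacunary_quot (b : C) (E : nat -> nat) (k : nat) : C :=
  Cpow b (E (S k) - 2 * E k).

Fixpoint lacunary_num (b : C) (E : nat -> nat) (k : nat) : C :=
  match k with
  | O => 1
  | S k => (lacunary_quot b E k * Cpow b (E k) * lacunary_num b E k + 1)%C
  end.

Lemma lacunary_den_succ (b : C) (E : nat -> nat) (k : nat) :
  doubling_exponents E ->
  Cpow b (E (S k)) = (lacunary_quot b E k * Cpow b (E k) * Cpow b (E k))%C.
Proof.
  intros H. unfold lacunary_quot. rewrite <- !Cpow_add_r. f_equal.
  assert (h := doubling_succ _ H k). lia.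
Qed.

(** Since [q (S k) = u k * q k * q k], the folding recursion divided by [q (S k)] becomes
    [P k / q k + 1 / q (S k)]. *)
Lemma sum_n_lacunary (b : C) (E : nat -> nat) (k : nat) :
  b <> 0 -> doubling_exponents E ->
  sum_n (fun i => 1 / Cpow b (E i))%C k = (lacunary_num b E k / Cpow b (E k))%C :> C.
Proof.
  intros hb H. induction k as [|k IH]; [apply sum_O|].
  rewrite sum_n_C_succ, IH. simpl lacunary_num. rewrite (lacunary_den_succ b E k H).
  field.
  split; apply Cpow_nz; auto.
Qed.

Lemma lacunary_tail (b : C) (E : nat -> nat) (z : C) (k : nat) :
  2 <= Cmod b -> doubling_exponents E ->
  is_series (fun i => 1 / Cpow b (E i))%C z ->
  Cmod (z - lacunary_num b E k / Cpow b (E k))%C <= 2 / Cmod b ^ E (S k).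
Proof.
  intros hb H hz.
  assert (hb0 : b <> 0) by (apply Cmod_gt_0; lra).
  set (T := fun i => Cmod b ^ E i).
  assert (hT : forall i, 0 < T i) by (intros; apply pow_lt; lra).
  assert (hTS : forall i, 2 * T i <= T (S i)).
  { intros i. unfold T.
    replace (E (S i)) with (S (E i) + (E (S i) - S (E i)))%nat
      by (assert (h := doubling_lt E i (S i) H); lia).
    rewrite pow_add. simpl.
    assert (1 <= Cmod b ^ (E (S i) - S (E i))) by (apply pow_R1_Rle; lra).
    assert (h := hT i). unfold T in h.
    rewrite <- (Rmult_1_r (2 * Cmod b ^ E i)). apply Rmult_le_compat; nra. }
  (* Subtracting the last term makes the induction on [l] close, because each term is at most half
     the preceding one in modulus. *)
  assert (hpart : forall l, Cmod (sum_n (fun i => 1 / Cpow b (E i))%C (S k + l)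
    - sum_n (fun i => 1 / Cpow b (E i))%C k)%C <= 2 / T (S k) - / T (S k + l)%nat).
  { assert (hterm : forall i, Cmod (1 / Cpow b (E i))%C = / T i).
    { intros i. rewrite Cmod_div by (now apply Cpow_nz).
      rewrite Cmod_1, Cmod_pow. unfold T, Rdiv. ring. }
    induction l as [|l IH].
    - rewrite Nat.add_0_r, sum_n_C_succ.
      replace (_ + _ - _)%C with (1 / Cpow b (E (S k)))%C by ring.
      rewrite hterm. right. field. specialize (hT (S k)). lra.
    - rewrite Nat.add_succ_r, sum_n_C_succ.
      set (s := sum_n _ (S k + l)) in *. set (s' := sum_n _ k) in *.
      replace (_ + _ - _)%C with (s - s' + 1 / Cpow b (E (S (S k + l))))%C by ring.
      apply Rle_trans with (1 := Cmod_triangle _ _). rewrite hterm.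
      assert (h : 2 * / T (S (S k + l)) <= / T (S k + l)%nat).
      { specialize (hTS (S k + l)%nat). specialize (hT (S k + l)%nat).
        apply Rle_trans with (2 * / (2 * T (S k + l)%nat)).
        - apply Rmult_le_compat_l; [lra|]. apply Rinv_le_contravar; lra.
        - right. field. lra. }
      lra. }
  rewrite <- sum_n_lacunary by auto.
  apply Rnot_lt_le. intros hlt.
  rewrite is_series_C_Cmod in hz.
  destruct (hz (Cmod (z - sum_n (fun i => 1 / Cpow b (E i))%C k)%C - 2 / T (S k)))
    as [n0 hn0]; [fold (T (S k)) in hlt; lra|].
  specialize (hn0 (S k + n0)%nat ltac:(lia)). specialize (hpart n0).
  assert (h : 0 < / T (S k + n0)%nat) by (now apply Rinv_0_lt_compat).
  set (s := sum_n _ (S k + n0)) in *. set (s' := sum_n _ k) in *.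
  assert (htri := Cmod_triangle (z - s) (s - s')).
  replace (z - s + (s - s'))%C with (z - s')%C in htri by ring. lra.
Qed.

Lemma lacunary_K_set (b : C) (E : nat -> nat) (z : C) :
  2 <= Cmod b -> doubling_exponents E ->
  is_series (fun i => 1 / Cpow b (E i))%C z -> K_set b [0%nat; 1%nat] z.
Proof.
  intros hb H hz.
  assert (hb0 : b <> 0) by (apply Cmod_gt_0; lra).
  (* The digit at [j] is 1 when [j] is a value of [E]. Searching [k < j] suffices, as
     [k + 2 <= E k]. *)
  set (d := fun j => if existsb (fun k => Nat.eqb (E k) j) (seq 0 j) then 1%nat else 0%nat).
  assert (hd1 : forall k, d (E k) = 1%nat).
  { intros k. unfold d. replace (existsb _ _) with true; auto.
    symmetry. apply existsb_exists. exists k. split; [|apply Nat.eqb_refl].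
    apply in_seq. assert (h := doubling_ge E k H). lia. }
  assert (hd0 : forall j, (forall k, E k <> j) -> d j = 0%nat).
  { intros j hj. unfold d. destruct (existsb _ _) eqn:e; auto.
    apply existsb_exists in e. destruct e as [k [_ hk]].
    apply Nat.eqb_eq in hk. now elim (hj k). }
  exists d. split.
  { intros j _. unfold d. destruct (existsb _ _); simpl; auto. }
  set (c := fun k => (RtoC (INR (d (S k))) / Cpow b (S k))%C).
  assert (hc : exists z', is_series c z').
  { apply ex_series_C_geom with (/ 2); [lra|]. intros k. unfold c.
    rewrite Cmod_div by (now apply Cpow_nz). rewrite Cmod_R, Cmod_pow.
    assert (hd : Rabs (INR (d (S k))) <= 1).
    { unfold d. destruct (existsb _ _); simpl; rewrite Rabs_pos_eq; lra. }
    assert (hp : 2 ^ k <= Cmod b ^ S k).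
    { apply Rle_trans with (Cmod b ^ k); [apply pow_incr; lra|].
      simpl. assert (0 < Cmod b ^ k) by (apply pow_lt; lra). nra. }
    assert (h2 : 0 < 2 ^ k) by (apply pow_lt; lra).
    rewrite pow_inv. unfold Rdiv. rewrite <- (Rmult_1_l (/ 2 ^ k)).
    apply Rmult_le_compat; auto; [apply Rabs_pos| |].
    - left. apply Rinv_0_lt_compat. lra.
    - apply Rinv_le_contravar; lra. }
  destruct hc as [z' hz'].
  assert (hzero : forall j, (forall k, E k <> S j) -> c j = 0).
  { intros j hj. unfold c. rewrite hd0 by auto. simpl. field. split; auto. now apply Cpow_nz. }
  assert (hone : forall k j, E k = S j -> c j = (1 / Cpow b (E k))%C).
  { intros k j hj. unfold c. now rewrite <- hj, hd1. }
  (* The digit series is indexed from 0, so position [E k] has index [E k - 1]; between consecutive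
     exponents all digits vanish. The two series thus agree along a subsequence of partial sums,
     hence in the limit. *)
  assert (hsum : forall k, sum_n c (E k - 1) = sum_n (fun i => 1 / Cpow b (E i))%C k).
  { induction k as [|k IH].
    - rewrite sum_O, sum_n_zero_prefix.
      + apply hone. assert (h := doubling_ge E 0 H). lia.
      + intros j hj. apply hzero. intros [|k] hk; [lia|].
        assert (h := doubling_lt E 0 (S k) H). lia.
    - assert (hlt := doubling_lt E k (S k) H ltac:(lia)).
      assert (hge := doubling_ge E k H).
      replace (E (S k) - 1)%nat with (S (E k - 1 + (E (S k) - E k - 1))) by lia.
      rewrite !sum_n_C_succ, sum_n_zero_stretch, IH.
      + f_equal. apply hone. lia.
      + intros j hj. apply hzero. intros i hi.
        destruct (Nat.lt_trichotomy i k) as [hik|[hik|hik]].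
        * assert (h := doubling_lt E i k H hik). lia.
        * subst i. lia.
        * destruct (Nat.eq_dec i (S k)) as [->|]; [lia|].
          assert (h := doubling_lt E (S k) i H). lia. }
  replace z with z'; auto. apply Ceq_of_Cmod_small. intros e he.
  rewrite is_series_C_Cmod in hz, hz'.
  destruct (hz (e / 2)) as [n1 h1]; [lra|].
  destruct (hz' (e / 2)) as [n2 h2]; [lra|].
  specialize (h1 (n1 + n2)%nat ltac:(lia)).
  assert (hge := doubling_ge E (n1 + n2) H).
  specialize (h2 (E (n1 + n2) - 1)%nat ltac:(lia)). rewrite hsum in h2.
  set (s := sum_n _ (n1 + n2)) in *.
  replace (z' - z)%C with (z' - s + - (z - s))%C by ring.
  apply Rle_lt_trans with (1 := Cmod_triangle _ _). rewrite Cmod_opp. lra.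
Qed.

(** * Finite sets of approximations and the irrationality exponent *)

Lemma Finite_of_list (A : Ensembles.Ensemble C) (l : list C) :
  (forall x, A x -> In x l) -> Finite_sets.Finite C A.
Proof.
  intros h.
  assert (hl : exists B, Finite_sets.Finite C B /\ forall x, In x l -> B x).
  { clear h. induction l as [|a l [B [hB h]]].
    - exists (Ensembles.Empty_set C). split; [constructor|intros x []].
    - exists (Ensembles.Add C B a). split; [now apply Add_preserves_Finite|].
      intros x [->|hx]; [now right; constructor | left; now apply h]. }
  destruct hl as [B [hB hlB]].
  apply Finite_downward_closed with B; auto. intros x hx. now apply hlB, h.
Qed.

Lemma gaussian_integers_bounded (B : R) :
  exists l : list C, forall x, gaussian_integer x -> Cmod x <= B -> In x l.
Proof.
  destruct (INR_unbounded B) as [m hm].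
  set (r := map (fun i => (Z.of_nat i - Z.of_nat m)%Z) (seq 0 (2 * m + 1))).
  assert (hr : forall a, Rabs (IZR a) <= B -> In a r).
  { intros a ha. apply in_map_iff. exists (Z.to_nat (a + Z.of_nat m)).
    assert (hab : (- Z.of_nat m <= a <= Z.of_nat m)%Z).
    { rewrite INR_IZR_INZ in hm. apply Rabs_le_between in ha.
      split; apply le_IZR; rewrite ?opp_IZR; lra. }
    split; [lia|]. apply in_seq. lia. }
  exists (map (fun ac => (IZR (fst ac), IZR (snd ac))) (list_prod r r)).
  intros x [a [c ->]] hx. apply in_map_iff. exists (a, c). split; auto.
  apply in_prod; apply hr; apply Rle_trans with (2 := hx);
    apply Rle_trans with (2 := Rmax_Cmod _); [apply Rmax_l|apply Rmax_r].
Qed.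

Lemma Finite_separated (A : Ensembles.Ensemble C) (z : C) :
  Finite_sets.Finite C A -> ~ A z ->
  exists e, 0 < e /\ forall w, A w -> e <= Cmod (z - w)%C.
Proof.
  induction 1 as [|A hA IH a ha]; intros hz.
  - exists 1. split; [lra|intros w []].
  - destruct IH as [e [he h]]; [intros h; apply hz; now left|].
    assert (hza : 0 < Cmod (z - a)%C).
    { apply Cmod_gt_0. intros h0. apply hz. right.
      replace z with (z - a + a)%C by ring. rewrite h0, Cplus_0_l. constructor. }
    exists (Rmin e (Cmod (z - a)%C)). split; [now apply Rmin_pos|].
    intros w [w' hw|w' hw].
    + apply Rle_trans with e; [apply Rmin_l|now apply h].
    + destruct hw. apply Rmin_r.
Qed.

Lemma Rpower_gt_of_base (s y x : R) :
  0 < s -> 0 < y -> Rpower y (/ s) < x -> y < Rpower x s.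
Proof.
  intros hs hy hx.
  replace y with (Rpower (Rpower y (/ s)) s) at 1.
  - apply Rlt_Rpower_l; auto. split; auto. apply exp_pos.
  - rewrite Rpower_mult, Rinv_l by lra. now apply Rpower_1.
Qed.

(** A finite set of approximants would stay at some distance [e > 0] from [z], which is not a
    Gaussian rational; but for large [|q|] the given approximations belong to this set and come
    closer than [e]. *)
Lemma infinitely_often_approximable_below (z : C) (t mu D : R) :
  0 < t -> mu < t -> 0 < D -> ~ gaussian_rational z ->
  (forall M, exists p q : C, gaussian_integer p /\ gaussian_integer q /\ q <> 0 /\
    M <= Cmod q /\ Cmod (z - p / q)%C <= D * Rpower (Cmod q) (- t)) ->
  infinitely_often_approximable z mu.
Proof.
  intros ht hmu hD hz happ hfin.
  destruct (Finite_separated _ z hfin) as [e [he hsep]].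
  { intros (p & q & hp & hq & hq0 & h & _). apply hz. exists p, q; auto. }
  (* The two thresholds give [D < |q|^(t - mu)], for membership, and [D / e < |q|^t], for
     closeness. *)
  destruct (happ (1 + Rmax (Rpower D (/ (t - mu))) (Rpower (D / e) (/ t))))
    as (p & q & hp & hq & hq0 & hM & h).
  assert (h1 := Rmax_l (Rpower D (/ (t - mu))) (Rpower (D / e) (/ t))).
  assert (h2 := Rmax_r (Rpower D (/ (t - mu))) (Rpower (D / e) (/ t))).
  assert (h3 : D < Rpower (Cmod q) (t - mu)) by (apply Rpower_gt_of_base; lra).
  assert (h4 : D / e < Rpower (Cmod q) t)
    by (apply Rpower_gt_of_base; [lra|now apply Rdiv_lt_0_compat|lra]).
  assert (hpos : 0 < Rpower (Cmod q) (- t)) by apply exp_pos.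
  assert (h5 : e <= Cmod (z - p / q)%C).
  { apply hsep. exists p, q. repeat split; auto.
    apply Rle_lt_trans with (1 := h).
    replace (- mu) with ((t - mu) + - t) by ring. rewrite Rpower_plus.
    now apply Rmult_lt_compat_r. }
  assert (h6 : D * Rpower (Cmod q) (- t) < e).
  { rewrite Rpower_Ropp. apply Rmult_lt_reg_r with (Rpower (Cmod q) t / e).
    - apply Rdiv_lt_0_compat; auto; apply exp_pos.
    - replace (e * (Rpower (Cmod q) t / e)) with (Rpower (Cmod q) t) by (field; lra).
      replace (D * / Rpower (Cmod q) t * (Rpower (Cmod q) t / e)) with (D / e); auto.
      field. assert (0 < Rpower (Cmod q) t) by apply exp_pos. lra. }
  lra.
Qed.

(** For [mu > t] the two inequalities for [p / q] force [|q| <= B], then [|p| <= B * (|z| + 1)],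
    which leaves finitely many pairs. *)
Lemma infinitely_often_approximable_le (z : C) (t mu c : R) :
  0 < t -> 0 < c ->
  (forall p q : C, gaussian_integer p -> gaussian_integer q -> q <> 0 ->
    c * Rpower (Cmod q) (- t) <= Cmod (z - p / q)%C) ->
  infinitely_often_approximable z mu -> mu <= t.
Proof.
  intros ht hc hlow hinf. apply Rnot_lt_le. intros hmu. apply hinf. clear hinf.
  set (B := Rpower (/ c) (/ (mu - t))).
  assert (hB : 0 < B) by apply exp_pos.
  destruct (gaussian_integers_bounded B) as [lq hlq].
  destruct (gaussian_integers_bounded (B * (Cmod z + 1))) as [lp hlp].
  apply Finite_of_list with
    (map (fun pq => (fst pq / snd pq)%C) (list_prod lp lq)).
  intros w (p & q & hp & hq & hq0 & -> & happ).
  apply in_map_iff. exists (p, q). split; auto.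
  assert (hq1 := gaussian_integer_Cmod_ge_1 q hq hq0).
  assert (hqB : Cmod q <= B).
  { apply Rnot_lt_le. intros hlt.
    assert (h : / c < Rpower (Cmod q) (mu - t))
      by (apply Rpower_gt_of_base; auto; [lra|now apply Rinv_0_lt_compat]).
    specialize (hlow p q hp hq hq0).
    replace (- t) with ((mu - t) + - mu) in hlow by ring.
    rewrite Rpower_plus in hlow.
    assert (hpos : 0 < Rpower (Cmod q) (- mu)) by apply exp_pos.
    assert (h1 : 1 < c * Rpower (Cmod q) (mu - t)).
    { apply Rmult_lt_reg_l with (/ c); [now apply Rinv_0_lt_compat|].
      rewrite <- Rmult_assoc, Rinv_l; lra. }
    nra. }
  apply in_prod; [apply hlp | now apply hlq]; auto.
  assert (h1 : Rpower (Cmod q) (- mu) <= 1).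
  { rewrite <- (Rpower_O (Cmod q)) by lra. apply Rle_Rpower; lra. }
  replace p with (q * (z + - (z - p / q)))%C by (field; exact hq0).
  rewrite Cmod_mult. apply Rmult_le_compat; auto; try apply Cmod_ge_0.
  apply Rle_trans with (1 := Cmod_triangle _ _). rewrite Cmod_opp. lra.
Qed.

(** Exponents strictly below [t] suffice for the supremum; because of the constant [D], [t] itself
    may fail to belong to the set. *)
Lemma irrationality_exponent_eq (z : C) (t c D : R) :
  0 < t -> 0 < c -> 0 < D -> ~ gaussian_rational z ->
  (forall p q : C, gaussian_integer p -> gaussian_integer q -> q <> 0 ->
    c * Rpower (Cmod q) (- t) <= Cmod (z - p / q)%C) ->
  (forall M, exists p q : C, gaussian_integer p /\ gaussian_integer q /\ q <> 0 /\
    M <= Cmod q /\ Cmod (z - p / q)%C <= D * Rpower (Cmod q) (- t)) ->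
  irrationality_exponent z = Finite t.
Proof.
  intros ht hc hD hz hlow happ. apply is_lub_Rbar_unique. split.
  - intros mu hmu. now apply infinitely_often_approximable_le with z c.
  - intros y hy.
    assert (h : forall mu, mu < t -> Rbar_le mu y).
    { intros mu hmu. apply hy. now apply infinitely_often_approximable_below with t D. }
    destruct y as [y| |]; simpl; auto.
    + apply Rnot_lt_le. intros hlt.
      specialize (h ((y + t) / 2) ltac:(lra)). simpl in h. lra.
    + now apply (h (t - 1)); lra.
Qed.

(** * Diophantine bounds for lacunary series *)

(** As [E (S k) - 2 * E k <= (t - 2) * E k + t], the multiplier has modulus at most
    [|b|^t * |q k|^(t - 2)]. *)
Lemma lacunary_folding_sequence (b : C) (E : nat -> nat) (t : R) :
  gaussian_integer b -> 2 <= Cmod b -> doubling_exponents E -> 2 <= t ->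
  (forall k, INR (E (S k)) <= t * INR (E k) + t) ->
  folding_sequence (lacunary_num b E) (fun k => Cpow b (E k)) (lacunary_quot b E)
    (fun x => Rpower (Cmod b) t * Rpower x (t - 2)).
Proof.
  intros hb hb2 H ht hE.
  assert (hu : forall k, gaussian_integer (lacunary_quot b E k))
    by (intros; now apply gaussian_integer_pow).
  assert (hL : 1 <= Rpower (Cmod b) t).
  { rewrite <- (Rpower_O (Cmod b)) by lra. apply Rle_Rpower; lra. }
  constructor; auto.
  - induction k as [|k IH]; simpl; [apply (gaussian_integer_IZR 1)|].
    apply gaussian_integer_add; [|apply (gaussian_integer_IZR 1)].
    auto using gaussian_integer_mul, gaussian_integer_pow.
  - intros k. now apply gaussian_integer_pow.
  - intros k. now apply lacunary_den_succ.
  - intros k. rewrite Cmod_pow. assert (h := doubling_ge E k H).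
    apply Rle_trans with (Cmod b ^ 1); [now rewrite pow_1|]. apply Rle_pow; [lra|lia].
  - intros k. unfold lacunary_quot. rewrite Cmod_pow. apply pow_R1_Rle. lra.
  - intros k. unfold lacunary_quot. rewrite !Cmod_pow, <- !Rpower_pow by lra.
    rewrite Rpower_mult, <- Rpower_plus. apply Rle_Rpower; [lra|].
    rewrite minus_INR by apply H. rewrite mult_INR. simpl. specialize (hE k). lra.
  - intros x hx. rewrite <- (Rmult_1_l 1). apply Rmult_le_compat; try lra.
    rewrite <- (Rpower_O x) by lra. apply Rle_Rpower; lra.
  - intros x y hx hxy. apply Rmult_le_compat_l; [lra|]. apply Rle_Rpower_l; lra.
Qed.

Lemma lacunary_close (b : C) (E : nat -> nat) (z : C) (e M : R) :
  2 <= Cmod b -> doubling_exponents E ->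
  is_series (fun i => 1 / Cpow b (E i))%C z -> 0 < e ->
  exists k, Cmod (z - lacunary_num b E k / Cpow b (E k))%C <= e /\
    M <= Cmod (Cpow b (E k)).
Proof.
  intros hb H hz he.
  destruct (Pow_x_infinity (Cmod b)) with (b := Rmax M (2 / e)) as [n hn].
  { rewrite Rabs_pos_eq; lra. }
  assert (h : forall m, (n <= m)%nat -> Rmax M (2 / e) <= Cmod b ^ m).
  { intros m hm. rewrite <- (Rabs_pos_eq (Cmod b ^ m)) by (apply pow_le; lra).
    apply Rge_le, hn. lia. }
  exists n. assert (hge := doubling_ge E n H).
  assert (hlt := doubling_lt E n (S n) H ltac:(lia)). split.
  - apply Rle_trans with (1 := lacunary_tail b E z n hb H hz).
    assert (h' := Rle_trans _ _ _ (Rmax_r _ _) (h (E (S n)) ltac:(lia))).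
    assert (hp : 0 < Cmod b ^ E (S n)) by (apply pow_lt; lra).
    apply Rmult_le_reg_r with (Cmod b ^ E (S n) / e); [now apply Rdiv_lt_0_compat|].
    replace (2 / _ * _) with (2 / e) by (field; lra).
    replace (e * _) with (Cmod b ^ E (S n)) by (field; lra). exact h'.
  - rewrite Cmod_pow. apply Rle_trans with (1 := Rmax_l M (2 / e)). apply h. lia.
Qed.

(** With [x = 4 * K * |q|], the quantity [phi x * x] is [|b|^t * x^(t - 1)]; the remaining factor
    [|q|] comes from [|p - q * z| = |q| * |z - p / q|]. *)
Lemma lacunary_lower_bound (b : C) (E : nat -> nat) (t : R) (z : C) :
  gaussian_integer b -> 2 <= Cmod b -> doubling_exponents E -> 2 <= t ->
  (forall k, INR (E (S k)) <= t * INR (E k) + t) ->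
  is_series (fun i => 1 / Cpow b (E i))%C z ->
  exists c, 0 < c /\ forall p q : C,
    gaussian_integer p -> gaussian_integer q -> q <> 0 ->
    c * Rpower (Cmod q) (- t) <= Cmod (z - p / q)%C.
Proof.
  intros hb hb2 H ht hE hz.
  destruct (folding_lower_bound _ _ _ _ z
    (lacunary_folding_sequence b E t hb hb2 H ht hE)) as [K [hK hlow]].
  { intros e M he. now apply lacunary_close. }
  set (G := 2 * K * Rpower (Cmod b) t * Rpower (4 * K) (t - 1)).
  assert (hG : 0 < G).
  { unfold G. apply Rmult_lt_0_compat; [apply Rmult_lt_0_compat; [lra|]|]; apply exp_pos. }
  exists (/ G). split; [now apply Rinv_0_lt_compat|].
  intros p q hp hq hq0. specialize (hlow p q hp hq hq0).
  assert (hq1 := gaussian_integer_Cmod_ge_1 q hq hq0).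
  replace (Cmod (p - q * z)%C) with (Cmod q * Cmod (z - p / q)%C) in hlow.
  2:{ rewrite <- Cmod_mult, <- Cmod_opp. f_equal. field. exact hq0. }
  assert (hqt : 0 < Rpower (Cmod q) t) by apply exp_pos.
  assert (heq : 2 * K * (Rpower (Cmod b) t * Rpower (4 * K * Cmod q) (t - 2) *
    (4 * K * Cmod q)) * (Cmod q * Cmod (z - p / q)%C)
    = G * Rpower (Cmod q) t * Cmod (z - p / q)%C).
  { rewrite <- (Rpower_1 (4 * K * Cmod q)) at 2 by nra.
    rewrite (Rmult_assoc (Rpower (Cmod b) t)), <- Rpower_plus.
    replace (t - 2 + 1) with (t - 1) by ring.
    rewrite <- Rpower_mult_distr by lra.
    replace (Rpower (Cmod q) t) with (Rpower (Cmod q) (t - 1) * Cmod q).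
    - unfold G. ring.
    - rewrite <- (Rpower_1 (Cmod q)) at 2 by lra. rewrite <- Rpower_plus.
      f_equal. ring. }
  rewrite heq in hlow. rewrite Rpower_Ropp.
  apply Rmult_le_reg_l with (G * Rpower (Cmod q) t); [now apply Rmult_lt_0_compat|].
  replace (_ * (/ G * _)) with 1 by (field; lra). exact hlow.
Qed.

(** The tail after level [k] is at most [2 / |b|^(E (S k))]; replacing [E (S k)] by [t * E k - 1]
    costs one factor [|b|]. *)
Lemma lacunary_approximations (b : C) (E : nat -> nat) (t : R) (z : C) :
  gaussian_integer b -> 2 <= Cmod b -> doubling_exponents E -> 2 <= t ->
  (forall k, INR (E (S k)) <= t * INR (E k) + t) ->
  (forall k, t * INR (E k) - 1 <= INR (E (S k))) ->
  is_series (fun i => 1 / Cpow b (E i))%C z ->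
  forall M, exists p q : C, gaussian_integer p /\ gaussian_integer q /\ q <> 0 /\
    M <= Cmod q /\ Cmod (z - p / q)%C <= 2 * Cmod b * Rpower (Cmod q) (- t).
Proof.
  intros hb hb2 H ht hE hE' hz M.
  assert (F := lacunary_folding_sequence b E t hb hb2 H ht hE).
  destruct (lacunary_close b E z 1 M hb2 H hz Rlt_0_1) as [k [_ hM]].
  exists (lacunary_num b E k), (Cpow b (E k)).
  repeat split; auto; try apply F.
  - apply Cpow_nz, Cmod_gt_0. lra.
  - apply Rle_trans with (1 := lacunary_tail b E z k hb2 H hz).
    unfold Rdiv. rewrite Rmult_assoc. apply Rmult_le_compat_l; [lra|].
    rewrite Cmod_pow, <- !Rpower_pow, <- Rpower_Ropp, Rpower_mult by lra.
    rewrite <- (Rpower_1 (Cmod b)) at 2 by lra. rewrite <- Rpower_plus.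
    apply Rle_Rpower; [lra|]. specialize (hE' k). lra.
Qed.

(** * The exponents of [xi] *)

Lemma xi_exponent_spec (t lambda : R) (n : nat) :
  0 < lambda * t ^ n ->
  INR (xi_exponent t lambda n) <= lambda * t ^ n < INR (xi_exponent t lambda n) + 1.
Proof.
  intros h. unfold xi_exponent.
  destruct (base_Int_part (lambda * t ^ n)) as [h1 h2].
  (* [Z.to_nat] would send a negative floor to 0; here the floor is nonnegative. *)
  assert (hz : (0 <= Int_part (lambda * t ^ n))%Z).
  { apply Zlt_succ_le, lt_IZR. rewrite succ_IZR. lra. }
  rewrite INR_IZR_INZ, Z2Nat.id by exact hz. lra.
Qed.

(** [n] is at least 1 plus the floor of [ln (3 / lambda) / ln t], so it exceeds this quotient. The
    value 3 makes the first exponent at least 2. *)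
Lemma n0_le_power (b : C) (lambda t : R) (n : nat) :
  2 <= t -> 0 < lambda -> n0 b lambda t <= INR n -> 3 < lambda * t ^ n.
Proof.
  intros ht hl hn. unfold n0 in hn.
  set (x := ln (3 / lambda) / ln t) in *.
  assert (h1 : x < INR n).
  { destruct (base_Int_part x) as [_ h2].
    assert (h3 := Rmax_l (IZR (Int_part x)) (ln 3 / ln (Cmod b))).
    assert (h4 := Rmax_r 0 (Rmax (IZR (Int_part x)) (ln 3 / ln (Cmod b)))). lra. }
  assert (hln : 0 < ln t) by (rewrite <- ln_1; apply ln_increasing; lra).
  assert (h5 : 3 / lambda < t ^ n).
  { rewrite <- Rpower_pow by lra.
    rewrite <- (exp_ln (3 / lambda)) by (apply Rdiv_lt_0_compat; lra).
    apply exp_increasing. replace (ln (3 / lambda)) with (x * ln t) by (unfold x; field; lra).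
    now apply Rmult_lt_compat_r. }
  replace 3 with (lambda * (3 / lambda)) by (field; lra).
  now apply Rmult_lt_compat_l.
Qed.

(** Turns the real threshold [n0] into a natural number: the ceiling is minus the floor of [- x],
    and [1 <= x] makes it a successor. *)
Lemma nat_ceiling (x : R) :
  1 <= x -> exists m, forall n, x <= INR n <-> (S m <= n)%nat.
Proof.
  intros hx. destruct (base_Int_part (- x)) as [h1 h2].
  set (z := Int_part (- x)) in *.
  assert (hz : (z < 0)%Z) by (apply lt_IZR; lra).
  exists (Z.to_nat (- z) - 1)%nat. intros n. rewrite INR_IZR_INZ. split; intros hn.
  - assert (- z - 1 < Z.of_nat n)%Z by (apply lt_IZR; rewrite minus_IZR, opp_IZR; lra).
    lia.
  - apply Rle_trans with (IZR (- z)); [rewrite opp_IZR; lra|]. apply IZR_le. lia.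
Qed.

(** Consecutive exponents are the floors of some [y] and of [t * y]. Hence
    [2 * E k <= t * y < E (S k) + 1], and integrality gives the doubling; likewise
    [E (S k) <= t * y < t * (E k + 1)]. *)
Lemma xi_exponents (b : C) (t lambda : R) (m : nat) :
  2 <= t -> 0 < lambda -> (forall n, n0 b lambda t <= INR n <-> (S m <= n)%nat) ->
  let E k := xi_exponent t lambda (S m + k) in
  doubling_exponents E /\
  (forall k, INR (E (S k)) <= t * INR (E k) + t) /\
  (forall k, t * INR (E k) - 1 <= INR (E (S k))).
Proof.
  intros ht hl hm E.
  assert (hx : forall k, 3 < lambda * t ^ (S m + k)).
  { intros k. apply n0_le_power with b; auto. apply hm. lia. }
  assert (hE : forall k, INR (E k) <= lambda * t ^ (S m + k) < INR (E k) + 1).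
  { intros k. apply xi_exponent_spec. specialize (hx k). lra. }
  assert (hS : forall k, lambda * t ^ (S m + S k) = t * (lambda * t ^ (S m + k))).
  { intros k. rewrite Nat.add_succ_r. simpl. ring. }
  split; [split|split].
  - apply INR_le. specialize (hE 0%nat). specialize (hx 0%nat). simpl INR. lra.
  - intros k. apply Nat.lt_succ_r, INR_lt. rewrite S_INR, mult_INR. simpl (INR 2).
    assert (h1 := hE k). assert (h2 := hE (S k)). rewrite hS in h2.
    specialize (hx k). nra.
  - intros k. assert (h1 := hE k). assert (h2 := hE (S k)). rewrite hS in h2. nra.
  - intros k. assert (h1 := hE k). assert (h2 := hE (S k)). rewrite hS in h2. nra.
Qed.

Lemma is_series_xi_term (b : C) (t lambda : R) (m : nat) (z : C) :
  (forall n, n0 b lambda t <= INR n <-> (S m <= n)%nat) ->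
  is_series (fun k => 1 / Cpow b (xi_exponent t lambda (S m + k)))%C z ->
  is_series (fun k => xi_term b t lambda (S k)) z.
Proof.
  intros hm hz.
  assert (hterm : forall k, xi_term b t lambda (S (m + k)) =
    (1 / Cpow b (xi_exponent t lambda (S m + k)))%C).
  { intros k. unfold xi_term. destruct (Rle_dec _ _) as [h|h]; auto.
    elim h. apply hm. lia. }
  (* Index [m] of the shifted series carries [n = S m], the first value past the threshold; all
     earlier terms are 0. *)
  assert (hsum : forall k, sum_n (fun k => xi_term b t lambda (S k)) (m + k) =
    sum_n (fun k => 1 / Cpow b (xi_exponent t lambda (S m + k)))%C k).
  { induction k as [|k IH].
    - rewrite Nat.add_0_r, sum_O, sum_n_zero_prefix.
      + rewrite <- hterm. now rewrite Nat.add_0_r.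
      + intros j hj. unfold xi_term. destruct (Rle_dec _ _) as [h|h]; auto.
        apply hm in h. lia.
    - rewrite Nat.add_succ_r, !sum_n_C_succ, IH. f_equal.
      rewrite <- hterm. now rewrite Nat.add_succ_r. }
  rewrite is_series_C_Cmod in hz |- *. intros e he.
  destruct (hz e he) as [k hk]. exists (m + k)%nat. intros n hn.
  replace n with (m + (n - m))%nat by lia. rewrite hsum. apply hk. lia.
Qed.

(** Convergence is part of the claim because [Series] also assigns values to divergent series. *)
Theorem theorem1p2 (A : nat) (b : C) (tau lambda : R)
  (hA : (2 <= A)%nat)
  (hb : b = (- RtoC (INR A) + Ci)%C \/ b = (- RtoC (INR A) - Ci)%C)
  (htau : 2 <= tau) (hlambda : 0 < lambda) :
  is_series (fun k : nat => xi_term b tau lambda (S k)) (xi b tau lambda) /\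
  K_set b [0%nat; 1%nat] (xi b tau lambda) /\
  ~ gaussian_rational (xi b tau lambda) /\
  irrationality_exponent (xi b tau lambda) = Finite tau /\
  (tau = 2 -> badly_approximable (xi b tau lambda)).
Proof.
  assert (hgauss : gaussian_integer b /\ 2 <= Cmod b).
  { assert (hA' : 2 <= INR A) by (apply (le_INR 2); exact hA).
    (* Both signs of the imaginary part are treated at once; the real part [- A] already gives
       [2 <= |b|]. *)
    assert (hpair : exists s : Z, b = (IZR (- Z.of_nat A), IZR s)).
    { rewrite opp_IZR, <- INR_IZR_INZ.
      destruct hb as [-> | ->]; [exists 1%Z | exists (-1)%Z];
        apply injective_projections; simpl; ring. }
    destruct hpair as [s ->]. split; [now exists (- Z.of_nat A)%Z, s|].
    apply Rle_trans with (2 := Rmax_Cmod _). apply Rle_trans with (2 := Rmax_l _ _).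
    simpl. rewrite opp_IZR, <- INR_IZR_INZ, Rabs_Ropp, Rabs_pos_eq; lra. }
  destruct hgauss as [hbg hb2].
  destruct (nat_ceiling (n0 b lambda tau)) as [m hm].
  { unfold n0. assert (h := Rmax_l 0 (Rmax (IZR (Int_part (ln (3 / lambda) / ln tau)))
      (ln 3 / ln (Cmod b)))). lra. }
  set (E := fun k => xi_exponent tau lambda (S m + k)).
  destruct (xi_exponents b tau lambda m htau hlambda hm) as (H & hE & hE').
  fold E in H, hE, hE'.
  assert (hz : exists z, is_series (fun k => 1 / Cpow b (E k))%C z).
  { apply ex_series_C_geom with (/ 2); [lra|]. intros k.
    rewrite Cmod_div by (apply Cpow_nz, Cmod_gt_0; lra).
    rewrite Cmod_1, Cmod_pow, pow_inv. unfold Rdiv. rewrite Rmult_1_l.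
    apply Rinv_le_contravar; [apply pow_lt; lra|].
    apply Rle_trans with (Cmod b ^ k); [apply pow_incr; lra|].
    apply Rle_pow; [lra|]. assert (h := doubling_ge E k H). lia. }
  destruct hz as [z hz].
  assert (hxi : is_series (fun k => xi_term b tau lambda (S k)) z)
    by (now apply is_series_xi_term with m).
  replace (xi b tau lambda) with z
    by (symmetry; exact (Series_Re_Im _ z hxi)).
  destruct (lacunary_lower_bound b E tau z hbg hb2 H htau hE hz) as [c [hc hlow]].
  assert (hirr : ~ gaussian_rational z).
  { intros (p & q & hp & hq & hq0 & h). specialize (hlow p q hp hq hq0).
    rewrite <- h in hlow. replace (z - z)%C with (RtoC 0) in hlow by ring.
    rewrite Cmod_0 in hlow.
    assert (hpos : 0 < Rpower (Cmod q) (- tau)) by apply exp_pos. nra. }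
  split; [exact hxi|split; [|split; [exact hirr|split]]].
  - now apply lacunary_K_set with E.
  - apply irrationality_exponent_eq with c (2 * Cmod b); auto; try lra.
    now apply lacunary_approximations with E.
  (* For [tau = 2] the lower bound with [|q|^(- tau)] is bad approximability itself. *)
  - intros ->. split; auto. exists c. split; auto. intros p q hp hq hq0.
    assert (hq1 := gaussian_integer_Cmod_ge_1 q hq hq0).
    rewrite <- Rpower_pow by lra. unfold Rdiv. rewrite <- Rpower_Ropp.
    now apply hlow.
Qed.
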